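(* Let $K$ be a global function field of characteristic $p$, fix a prime $\infty$ of $K$, let $\mathcal{O}$ be the ring of elements of $K$ regular at every prime other than $\infty$, and let $\mathbb{F}_q$ be the full constant field of $K$ (so $\mathcal{O}^*=\mathbb{F}_q^*$). Let $\phi\in\mathcal{O}[X]$ be a polynomial of degree at least $2$ with leading coefficient in $\mathcal{O}^*$, regarded as a map $K\to K$. Then every periodic point of $\phi$ in $K$ lies in $\mathcal{O}$ and has minimal period at most $q$.
   Context: A global function field is a finite extension of $\mathbb{F}_p(t)$; its primes are its places. The full constant field is the algebraic closure of $\mathbb{F}_p$ in $K$. A point $x\in K$ is periodic if $\phi^n(x)=x$ for some $n\geqslant 1$, where $\phi^n$ is the $n$-fold iterate; the least such $n$ is its minimal period. *)

(* Defs.v *)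
From HB Require Import structures.
From mathcomp Require Import all_boot all_order all_algebra all_field.
From mathcomp Require Export fraction.
Set Implicit Arguments. Unset Strict Implicit. Unset Printing Implicit Defensive.
Import Order.TTheory GRing.Theory Num.Theory.
Local Open Scope ring_scope.

(* The rational function field F_p(t). A global function field of
   characteristic p is (up to choice of t) a finite-dimensional field
   extension of F_p(t): we model it as K : fieldExtType (Fpt p). *)
Definition Fpt (p : nat) := {fraction {poly 'F_p}}.

(* A prime (place) of K is represented by its normalized discrete valuation
   v : K^* ->> Z (the value at 0 is irrelevant / ignored). *)
Definition is_place (K : fieldType) (v : K -> int) : Prop :=
  [/\ forall x y : K, x != 0 -> y != 0 -> v (x * y) = v x + v y,
      forall x y : K, x != 0 -> y != 0 -> x + y != 0 ->
        Order.min (v x) (v y) <= v (x + y)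
    & exists x : K, x != 0 /\ v x = 1].

Definition same_place (K : fieldType) (v w : K -> int) : Prop :=
  forall x : K, x != 0 -> v x = w x.

Definition in_O (K : fieldType) (vinf : K -> int) (x : K) : Prop :=
  forall v : K -> int, is_place v -> ~ same_place v vinf ->
    x != 0 -> 0 <= v x.

Definition unit_O (K : fieldType) (vinf : K -> int) (x : K) : Prop :=
  [/\ x != 0, in_O vinf x & in_O vinf x^-1].

Definition Fp_emb (p : nat) (K : fieldExtType (Fpt p)) (c : 'F_p) : K :=
  (@FracField.tofrac _ (c%:P))%:A.

Definition is_constant (p : nat) (K : fieldExtType (Fpt p)) (x : K) : Prop :=
  exists a : {poly 'F_p}, a != 0 /\ root (map_poly (@Fp_emb p K) a) x.

(* Main.v *)
(* A periodic point is integral because the value at any place where it has a pole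
   strictly decreases along its orbit.  For an integral orbit x_0, x_1, ... of exact
   period m, x_i - x_j divides phi(x_i) - phi(x_j); going around the cycle,
   x_{i+1} - x_i = u_i (x_1 - x_0) with u_i a unit of O.  Units of O are constants,
   so every x_i lies in x_0 + F_q (x_1 - x_0), whence m <= q.

   That units are constants needs, for every nonconstant u, a place v with v u > 0.
   By Zorn there is a maximal subring V containing u but not 1/u, and V is a valuation
   ring.  If N = [K : F_p(t)], then x^(N!) is associate modulo V^* to an element of
   F_p(t) for every nonzero x, and all of F_p(t)^* is associate to powers of a single
   non-unit pi, a polynomial of least degree in t or 1/t.  The exponent of pi, suitably
   normalised, is the required valuation. *)
From mathcomp Require Import boolp classical_sets.
Require Import Defs.
From HB Require Import structures.
From mathcomp Require Import all_boot all_order all_algebra all_field.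
From mathcomp Require Import ring zify.
Import Order.TTheory GRing.Theory Num.Theory.
Local Open Scope ring_scope.
Set Implicit Arguments.
Unset Strict Implicit.

(** * Subrings of a field *)

Definition is_subring (K : fieldType) (A : K -> Prop) : Prop :=
  [/\ A 1, forall x y, A x -> A y -> A (x - y)
    & forall x y, A x -> A y -> A (x * y)].

Section Subring.

Variables (K : fieldType) (A : K -> Prop).
Hypothesis subA : is_subring A.

Lemma subring1 : A 1. Proof. by case: subA. Qed.

Lemma subringB x y : A x -> A y -> A (x - y). Proof. by case: subA => _ + _; apply. Qed.

Lemma subringM x y : A x -> A y -> A (x * y). Proof. by case: subA => _ _; apply. Qed.

Lemma subring0 : A 0.
Proof. by rewrite -(subrr 1); apply: subringB; apply: subring1. Qed.

Lemma subringN x : A x -> A (- x).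
Proof. by move=> Ax; rewrite -sub0r; apply: subringB => //; apply: subring0. Qed.

Lemma subringD x y : A x -> A y -> A (x + y).
Proof. by move=> Ax Ay; rewrite -[y]opprK; apply: subringB => //; apply: subringN. Qed.

Lemma subringX x n : A x -> A (x ^+ n).
Proof.
move=> Ax; elim: n => [|n IHn]; first exact: subring1.
by rewrite exprS; apply: subringM.
Qed.

Lemma subring_sum (I : Type) (r : seq I) (P : pred I) (F : I -> K) :
  (forall i, P i -> A (F i)) -> A (\sum_(i <- r | P i) F i).
Proof. by move=> AF; apply: big_ind => //; [apply: subring0 | apply: subringD]. Qed.

Lemma subring_nat n : A n%:R.
Proof.
elim: n => [|n IHn]; first exact: subring0.
by rewrite -natr1; apply: subringD => //; apply: subring1.
Qed.

Lemma subring_horner (f : {poly K}) x : (forall i, A f`_i) -> A x -> A f.[x].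
Proof.
move=> Af Ax; rewrite horner_coef; apply: subring_sum => i _.
by apply: subringM => //; apply: subringX.
Qed.

(** Termwise, [x ^+ i - y ^+ i] is [x - y] times an element of [A]. Used at poles, where the points
    are [y^-1] and 0, and for differences along a cycle. *)
Lemma subring_hornerB (f : {poly K}) x y : (forall i, A f`_i) -> A x -> A y ->
  exists2 g, A g & f.[x] - f.[y] = g * (x - y).
Proof.
move=> Af Ax Ay.
exists (\sum_(i < size f) f`_i * \sum_(j < i) x ^+ (i.-1 - j) * y ^+ j).
  apply: subring_sum => i _; apply: subringM => //; apply: subring_sum => j _.
  by apply: subringM; apply: subringX.
rewrite !horner_coef -sumrB mulr_suml; apply: eq_bigr => i _.
by rewrite -mulrBr subrXX; ring.
Qed.

Lemma adjoin_subring x :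
  is_subring (fun y => exists2 f : {poly K}, forall i, A f`_i & y = f.[x]).
Proof.
split.
- exists 1; last by rewrite hornerC.
  by move=> i; rewrite coef1; apply: subring_nat.
- move=> _ _ [f Af ->] [g Ag ->]; exists (f - g); last by rewrite !hornerE.
  by move=> i; rewrite coefB; apply: subringB.
- move=> _ _ [f Af ->] [g Ag ->]; exists (f * g); last by rewrite hornerM.
  move=> i; rewrite coefM; apply: subring_sum => j _; exact: subringM.
Qed.

End Subring.

(** Trades powers of [x^-1] for powers of [x]; [n] may exceed the degree of [g], which pads the
    reversal by a power of the variable. *)
Lemma horner_rev (K : fieldType) (g : {poly K}) (x : K) n :
  x != 0 -> (size g <= n.+1)%N ->
  (\poly_(i < n.+1) g`_(n - i)).[x] = x ^+ n * g.[x^-1].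
Proof.
move=> x0 sg; rewrite horner_poly (horner_coef_wide _ sg) mulr_sumr.
rewrite (reindex_inj rev_ord_inj) /=; apply: eq_bigr => i _.
have ilen : (i <= n)%N by rewrite -ltnS.
rewrite subSS subKn // exprVn mulrCA; congr (_ * _).
have -> : x ^+ n = x ^+ (n - i) * x ^+ i by rewrite -exprD subnK.
by rewrite mulfK // expf_neq0.
Qed.

(** * Maximal subrings omitting [u^-1] are valuation rings *)

Section Maximal.

Variables (K : fieldType) (u : K) (R : K -> Prop).
Hypotheses (subR : is_subring R) (Ru : R u) (RVu : ~ R u^-1).
Hypothesis maxR : forall B : K -> Prop, is_subring B -> (forall x, R x -> B x) ->
  ~ B u^-1 -> forall x, B x -> R x.

Lemma maximal_nonunit_neq0 : u != 0.
Proof. by apply/eqP => u0; apply: RVu; rewrite u0 invr0 -u0. Qed.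

Let u0 := maximal_nonunit_neq0.

(** Puts [u] in the Jacobson radical of [R]: inverting [s = 1 - u * r] gives a ring that still omits
    [u^-1], because the powers of [s] are 1 modulo [u], so maximality puts [s^-1] in [R]. *)
Lemma maximal_inv r : R r -> 1 - u * r != 0 /\ R (1 - u * r)^-1.
Proof.
move=> Rr; set s := 1 - u * r.
have Rs : R s by apply: subringB => //; [apply: subring1 | apply: subringM].
have s0 : s != 0.
  apply/eqP => /eqP; rewrite subr_eq0 => /eqP e; apply: RVu.
  by rewrite -(mulKf u0 r) -e mulr1 in Rr.
split=> //.
apply: (maxR (B := fun y => exists n, R (y * s ^+ n))).
- split.
  + by exists 0%N; rewrite mulr1; apply: subring1.
  + move=> x y [n Rx] [m Ry]; exists (n + m)%N; rewrite exprD.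
    have -> : (x - y) * (s ^+ n * s ^+ m) =
      x * s ^+ n * s ^+ m - y * s ^+ m * s ^+ n by ring.
    by apply: subringB => //; apply: subringM => //; apply: subringX.
  + move=> x y [n Rx] [m Ry]; exists (n + m)%N; rewrite exprD mulrACA.
    exact: subringM.
- by move=> x Rx; exists 0%N; rewrite mulr1.
- case=> n Rn.
  have [r' Rr' e] : exists2 r', R r' & s ^+ n = 1 - u * r'.
    elim: n {Rn} => [|n [r' Rr' IHn]].
      by exists 0; [apply: subring0 | rewrite mulr0 subr0].
    exists (r' + r - u * r * r').
      by apply: subringB => //; [apply: subringD | do 2!apply: subringM => //].
    by rewrite exprS IHn /s; ring.
  apply: RVu; have -> : u^-1 = u^-1 * s ^+ n + r' by rewrite e; field.
  exact: subringD.
- by exists 1%N; rewrite expr1 mulVf //; apply: subring1.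
Qed.

(** Descent on the total size of two relations that express [u^-1] in R[x] and in R[1/x]. In the
    shorter one, [1 - u * g_0] is invertible by [maximal_inv], which allows the leading term of the
    longer one to be removed. *)
Lemma maximal_no_relation n (x : K) (f g : {poly K}) :
  x != 0 -> ~ R x -> ~ R x^-1 ->
  (forall i, R f`_i) -> (forall i, R g`_i) -> u * f.[x] = 1 -> u * g.[x^-1] = 1 ->
  (size f + size g <= n)%N -> False.
Proof.
elim: n x f g => [|n IHn] x f g x0 Rx RVx Rf Rg ef eg.
  rewrite leqn0 addn_eq0 size_poly_eq0 => /andP [/eqP f0 _].
  by move/eqP: ef; rewrite f0 horner0 mulr0 eq_sym oner_eq0.
wlog le_gf : x f g x0 Rx RVx Rf Rg ef eg / (size g <= size f)%N.
  move=> H; case: (leqP (size g) (size f)) => [|/ltnW] le; first exact: (H x f g).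
  by rewrite addnC; apply: (H x^-1 g f); rewrite ?invrK ?invr_eq0.
have sg1 : (1 < size g)%N.
  rewrite ltnNge; apply/negP => /size1_polyC e; apply: RVu.
  move: eg; rewrite e hornerC => eg.
  by have -> : u^-1 = g`_0 by rewrite -[LHS]mulr1 -eg mulKf.
move=> size_le.
case: (maximal_inv (Rg 0%N)) => s0 RVs; set s := _ - _ in s0 RVs.
have [h [Rh sh eh]] : exists h : {poly K},
    [/\ forall i, R h`_i, (size h).+1 = size g & u * (h.[x^-1] * x^-1) = s].
  exists (drop_poly 1 g); split.
  - by move=> i; rewrite coef_drop_poly.
  - by rewrite size_drop_poly subn1 prednK // ltnW.
  - rewrite /s -eg -{2}[g](poly_take_drop 1) hornerD hornerM hornerXn.
    have -> : take_poly 1 g = (g`_0)%:P.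
      by apply/polyP => i; rewrite coef_take_poly coefC; case: i.
    by rewrite hornerC; ring.
have [k sf] : exists k, size f = k.+2.
  by move: (leq_trans sg1 le_gf); case: (size f) => [|[|k]] // _; exists k.
pose a := f`_k.+1; have Ra : R a by apply: Rf.
(* Since [s * x = u * h.[x^-1]], the leading term [a * x ^+ k.+1] of [f] equals [a * s^-1 * u * x ^+
   k * h.[x^-1]], of degree at most [k] in [x] because [h] has size at most [k.+1]. *)
pose f1 := \poly_(i < k.+1) f`_i + (a * s^-1 * u) *: \poly_(i < k.+1) h`_(k - i).
have sf1 : (size f1 <= k.+1)%N.
  rewrite /f1; apply: leq_trans (size_polyD _ _) _; rewrite geq_max size_poly /=.
  by apply: leq_trans (size_scale_leq _ _) _; apply: size_poly.
apply: (IHn x f1 g) => //; last by move: size_le; rewrite sf; lia.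
- move=> i; rewrite coefD coefZ !coef_poly; apply: subringD => //.
    by case: ifP => // _; apply: subring0.
  apply: subringM => //; first by do 2!apply: subringM => //.
  by case: ifP => // _; apply: subring0.
- rewrite -ef; congr (_ * _); rewrite hornerD hornerZ horner_rev //; last first.
    by rewrite -ltnS sh -sf.
  rewrite horner_poly [f.[x]]horner_coef sf [RHS]big_ord_recr /=; congr (_ + _).
  rewrite -/a -mulrA -mulrA; congr (_ * _).
  have -> : s^-1 * (u * (x ^+ k * h.[x^-1])) =
      x ^+ k.+1 * s^-1 * (u * (h.[x^-1] * x^-1)).
    by rewrite exprS; field; rewrite x0 s0.
  by rewrite eh mulfVK.
Qed.

(** For [y] outside [R], the larger ring R[y] must contain [u^-1]; taking [y] to be [x] and [x^-1]
    gives the two relations excluded by [maximal_no_relation]. *)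
Lemma maximal_valuation x : R x \/ R x^-1.
Proof.
apply: contrapT => /not_orP [Rx RVx].
have x0 : x != 0 by apply/eqP => x0; apply: Rx; rewrite x0; apply: subring0.
have adj y : ~ R y -> exists2 f : {poly K}, forall i, R f`_i & u * f.[y] = 1.
  move=> Ry; apply: contrapT => nf; apply: Ry.
  apply: (maxR (adjoin_subring subR y)).
  - move=> z Rz; exists z%:P; last by rewrite hornerC.
    by move=> i; rewrite coefC; case: ifP => // _; apply: subring0.
  - by case=> f Rf e; apply: nf; exists f => //; rewrite -e mulfV.
  - exists 'X; last by rewrite hornerX.
    by move=> i; rewrite coefX; apply: subring_nat.
have [f Rf ef] := adj _ Rx; have [g Rg eg] := adj _ RVx.
exact: (@maximal_no_relation _ x f g _ _ _ _ _ _ _ (leqnn _)).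
Qed.

End Maximal.

Lemma exists_valuation_ring (K : fieldType) (A : K -> Prop) (u : K) :
  is_subring A -> A u -> ~ A u^-1 ->
  exists V : K -> Prop, [/\ is_subring V, forall x, A x -> V x, ~ V u^-1
    & forall x, V x \/ V x^-1].
Proof.
move=> subA Au AVu.
pose good (B : K -> Prop) := [/\ is_subring B, forall x, A x -> B x & ~ B u^-1].
(* The empty set is admitted so that the empty chain has a union. *)
have [F FP totF|V [PV maxV]] := @Zorn_bigcup K (fun B => (forall x, ~ B x) \/ good B).
  case: (pselect (exists2 X, F X & good X)) => [[X0 FX0 [sX0 AX0 _]]|no]; last first.
    left => x [X FX Xx]; case: (FP X FX) => [/(_ x)//|gX].
    by apply: no; exists X.
  have gF X x : F X -> X x -> good X by move=> /FP [/(_ x)|].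
  right; split.
  - have pair X Y x y : F X -> F Y -> X x -> Y y -> exists Z, [/\ F Z, Z x & Z y].
      move=> FX FY Xx Yy; case: (totF X Y FX FY) => s.
        by exists Y; split=> //; apply: s.
      by exists X; split=> //; apply: s.
    split.
    + by exists X0 => //; apply: subring1.
    + move=> x y [X FX Xx] [Y FY Yy]; have [Z [FZ Zx Zy]] := pair _ _ _ _ FX FY Xx Yy.
      by case: (gF _ _ FZ Zx) => sZ _ _; exists Z => //; apply: subringB.
    + move=> x y [X FX Xx] [Y FY Yy]; have [Z [FZ Zx Zy]] := pair _ _ _ _ FX FY Xx Yy.
      by case: (gF _ _ FZ Zx) => sZ _ _; exists Z => //; apply: subringM.
  - by move=> x /AX0 Xx; exists X0.
  - by case=> X FX Xu; case: (gF _ _ FX Xu).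
have gV : good V.
  (* An empty maximal set is ruled out by [A] itself, which contains [u]. *)
  case: PV => // V0; case: (maxV A); last by right; split.
  by split=> [x /V0 //|sub]; case: (V0 u); apply: sub.
case: gV => sV AV VVu; exists V; split=> //.
apply: (@maximal_valuation K u V sV (AV _ Au) VVu) => B sB VB BVu x Bx.
apply: contrapT => Vx; apply: (maxV B); last by right; split=> // y /AV /VB.
by split=> // /(_ _ Bx).
Qed.

(** * Values as classes modulo the units of a valuation ring *)

Section ValuationRing.

Variables (K : fieldType) (V : K -> Prop).
Hypotheses (sV : is_subring V) (valV : forall x, V x \/ V x^-1).

(** The value group K^*/V^* is never formed as a quotient: that [x] and [y] have equal values is
    expressed by [vunit (x / y)]. *)
Definition vunit (x : K) : Prop := [/\ x != 0, V x & V x^-1].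

Lemma vunit1 : vunit 1.
Proof. by split; rewrite ?oner_eq0 ?invr1 //; apply: subring1. Qed.

Lemma vunitM x y : vunit x -> vunit y -> vunit (x * y).
Proof.
move=> [x0 Vx VVx] [y0 Vy VVy]; split; first by rewrite mulf_neq0.
  exact: subringM.
by rewrite invfM; apply: subringM.
Qed.

Lemma vunitV x : vunit x -> vunit x^-1.
Proof. by move=> [x0 Vx VVx]; split; rewrite ?invr_eq0 ?invrK. Qed.

Lemma vunitX x n : vunit x -> vunit (x ^+ n).
Proof.
move=> Ux; elim: n => [|n IHn]; first exact: vunit1.
by rewrite exprS; apply: vunitM.
Qed.

(** The value group is torsion-free: if [x^-1] is in [V], so is [x = x ^+ n * x^-1 ^+ n.-1], and
    symmetrically for [x^-1]. *)
Lemma vunit_of_exp x n : (0 < n)%N -> x != 0 -> vunit (x ^+ n) -> vunit x.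
Proof.
case: n => // n _ x0 [_ Vxn VVxn]; split=> //.
- case: (valV x) => // VVx.
  have -> : x = x ^+ n.+1 * x^-1 ^+ n.
    by rewrite exprS exprVn mulfK ?expf_neq0.
  by apply: subringM => //; apply: subringX.
- case: (valV x) => // Vx.
  have -> : x^-1 = (x ^+ n.+1)^-1 * x ^+ n.
    by rewrite exprS invfM mulfVK ?expf_neq0.
  by apply: subringM => //; apply: subringX.
Qed.

(** Compare [w] with [1 + w]: either [w / (1 + w)] lies in [V], hence so does
    [(1 + w)^-1 = 1 - w / (1 + w)], or [(1 + w) / w] does, which would make [w] a unit. *)
Lemma vunit_add1 w : V w -> ~ vunit w -> vunit (1 + w).
Proof.
move=> Vw Uw; have [->|w0] := eqVneq w 0; first by rewrite addr0; apply: vunit1.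
have VVw : ~ V w^-1 by move=> VVw; apply: Uw.
have w10 : 1 + w != 0.
  apply/eqP => e; apply: VVw; rewrite -(addKr 1 w) e addr0 invrN1.
  by apply: subringN => //; apply: subring1.
have V1w : V (1 + w) by apply: subringD => //; apply: subring1.
split=> //; case: (valV (w / (1 + w))) => [Vq|].
  have -> : (1 + w)^-1 = 1 - w / (1 + w) by field.
  by apply: subringB => //; apply: subring1.
rewrite invf_div => Vq; case: VVw; have -> : w^-1 = (1 + w) / w - 1 by field.
by apply: subringB => //; apply: subring1.
Qed.

(** The equality case of the ultrametric inequality: once the summand of smaller value is factored
    out, what remains is 1 plus a non-unit of [V]. *)
Lemma vunit_addr x y : x != 0 -> y != 0 -> ~ vunit (x / y) ->
  vunit ((x + y) / x) \/ vunit ((x + y) / y).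
Proof.
move=> x0 y0 Uxy; case: (valV (x / y)) => Vq.
  right; have -> : (x + y) / y = 1 + x / y by field.
  exact: vunit_add1.
left; rewrite invf_div in Vq; have -> : (x + y) / x = 1 + y / x by field.
by apply: vunit_add1 => // /vunitV; rewrite invf_div.
Qed.

(* Pairwise non-associate summands have distinct values, so the sum has the value
   of the dominant one; in particular it does not vanish. *)
Lemma vunit_sum (I : eqType) (T : I -> K) (s : seq I) :
  s != [::] -> uniq s -> {in s, forall i, T i != 0} ->
  {in s &, forall i j, i != j -> ~ vunit (T i / T j)} ->
  exists2 i, i \in s & vunit ((\sum_(j <- s) T j) / T i).
Proof.
elim: s => // i [|j s] IHs _ /andP [nis us] T0 TU.
  exists i; first exact: mem_head.
  by rewrite big_seq1 mulfV ?T0 ?mem_head //; apply: vunit1.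
have [//|//|||k ks Uk] := IHs.
- by move=> k ks; apply: T0; rewrite inE ks orbT.
- by move=> k l ks ls; apply: TU; rewrite inE ?ks ?ls orbT.
rewrite big_cons; set S := \sum_(j0 <- _) _ in Uk *.
have S0 : S != 0 by case: Uk; rewrite mulf_eq0 => /norP [].
have Ti0 : T i != 0 by rewrite T0 ?mem_head.
have Tk0 : T k != 0 by rewrite T0 // inE ks orbT.
have ik : i != k by apply: contraNneq nis => ->.
case: (@vunit_addr (T i) S) => // [US|Ui|Us].
- have ks' : k \in i :: j :: s by rewrite inE ks orbT.
  case: (TU i k (mem_head _ _) ks' ik).
  have -> : T i / T k = (T i / S) * (S / T k) by rewrite mulrA mulfVK.
  exact: vunitM.
- by exists i; first exact: mem_head.
- exists k; first by rewrite inE ks orbT.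
  have -> : (T i + S) / T k = (T i + S) / S * (S / T k) by rewrite mulrA mulfVK.
  exact: vunitM.
Qed.

End ValuationRing.

(** * Powers in a finite extension are associate to base elements *)

Section FiniteExtension.

Variables (F : fieldType) (K : fieldExtType F) (V : K -> Prop).
Hypotheses (sV : is_subring V) (valV : forall x, V x \/ V x^-1).

(** The terms of the minimal polynomial at [x] sum to zero, so by [vunit_sum] two of them, of
    indices j < i, are associate; then [x ^+ (i - j)] is associate to a quotient of their
    coefficients. *)
Lemma expr_assoc_base (x : K) : x != 0 ->
  exists e (a : F), [/\ (0 < e <= \dim {:K})%N, a != 0 & vunit V (x ^+ e / a%:A)].
Proof.
move=> x0; set P := minPoly 1%VS x.
have [k Pk] : exists k : nat -> F, forall i, P`_i = (k i)%:A.
  have {}Pk i : exists c : F, P`_i = c%:A.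
    by apply/vlineP; move/polyOverP: (minPolyOver 1%AS x); apply.
  by have [k hk] := choice Pk; exists k.
have sP : (size P <= (\dim {:K}).+1)%N.
  rewrite size_minPoly ltnS adjoin_degreeE dimv1 divn1.
  exact/dimvS/subvf.
have P0 : P != 0 by apply/monic_neq0/monic_minPoly.
pose s := [seq i <- iota 0 (size P) | k i != 0].
have ks i : i \in s -> (i < size P)%N /\ k i != 0.
  by rewrite mem_filter mem_iota add0n => /andP [].
have A0 (a : F) : a != 0 -> a%:A != 0 :> K.
    by move=> a0; rewrite scaler_eq0 negb_or a0 oner_eq0.
pose T i := (k i)%:A * x ^+ i : K.
have T0 i : i \in s -> T i != 0.
  by move=> /ks [_ ki]; rewrite mulf_neq0 ?A0 ?expf_neq0.
have sumT : \sum_(i <- s) T i = 0.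
  rewrite -[RHS](rootP (root_minPoly 1%AS x)) -/P horner_coef big_filter.
  rewrite big_mkcond -(big_mkord xpredT (fun i => P`_i * x ^+ i)) /index_iota subn0.
  by apply: eq_bigr => i _; rewrite Pk /T; case: eqP => //= ->; rewrite scale0r mul0r.
have s0 : s != [::].
  suff : (size P).-1 \in s by case: (s).
  rewrite mem_filter mem_iota leq0n add0n prednK ?size_poly_gt0 // leqnn !andbT.
  apply/eqP => k0; move/eqP: (oner_neq0 K); apply.
  by rewrite -(monicP (monic_minPoly 1%VS x)) lead_coefE -/P Pk k0 scale0r.
have us : uniq s by rewrite filter_uniq // iota_uniq.
have [i [j [is_ js ij Uij]]] : exists i j,
      [/\ i \in s, j \in s, (j < i)%N & vunit V (T i / T j)].
  apply: contrapT => nij.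
  have [||i _ []] := @vunit_sum K V sV valV _ T s s0 us;
    last by rewrite sumT mul0r eqxx.
    by move=> i; apply: T0.
  move=> i j is_ js; rewrite neq_ltn => /orP [] lt U; apply: nij.
    by exists j, i; split=> //; rewrite -invf_div; apply: vunitV.
  by exists i, j.
have [ilt ki] := ks _ is_; have [jlt kj] := ks _ js.
exists (i - j)%N, (k j / k i); split.
- by rewrite subn_gt0 ij /= -ltnS (leq_trans _ sP) // (leq_ltn_trans _ ilt) // leq_subr.
- by rewrite mulf_neq0 ?invr_eq0.
- have -> : x ^+ (i - j) / (k j / k i)%:A = T i / T j; last by [].
  have xi : x ^+ i = x ^+ (i - j) * x ^+ j by rewrite -exprD subnK // ltnW.
  rewrite /T xi -!in_algE rmorphM fmorphV /=.
  by field; rewrite expf_neq0 // !A0.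
Qed.

(** The exponent given by [expr_assoc_base] varies with [x]; the factorial is a common multiple of
    all possible ones. *)
Lemma exprfact_assoc_base (x : K) : x != 0 ->
  exists2 a : F, a != 0 & vunit V (x ^+ (\dim {:K})`! / a%:A).
Proof.
move=> x0; have [e [a [elt a0 Ue]]] := expr_assoc_base x0.
exists (a ^+ ((\dim {:K})`! %/ e)); first exact: expf_neq0.
have e_dvd := dvdn_fact elt.
have {1}-> : (\dim {:K})`! = (e * ((\dim {:K})`! %/ e))%N by rewrite mulnC divnK.
by rewrite exprM -!in_algE rmorphXn -expr_div_n; apply: vunitX.
Qed.

End FiniteExtension.

(** * The rational function field and a uniformizer *)

HB.instance Definition _ (p : nat) (K : fieldExtType (Fpt p)) :=
  GRing.RMorphism.copy (@Fp_emb p K) (in_alg K \o @FracField.tofrac _ \o polyC).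

Section FunctionField.

Variables (p : nat) (K : fieldExtType (Fpt p)).

Local Notation ev s f := (map_poly (@Fp_emb p K) f).[s].

Let t : K := (FracField.tofrac 'X)%:A.

Lemma tofrac_algE (f : {poly 'F_p}) : (FracField.tofrac f)%:A = ev t f.
Proof.
elim/poly_ind: f => [|f c IHf].
  by rewrite tofrac0 scale0r rmorph0 horner0.
rewrite [in RHS]rmorphD [in RHS]rmorphM /= map_polyX map_polyC !hornerE -IHf /t.
by rewrite -!in_algE !rmorphD !rmorphM.
Qed.

Lemma fraction_numden (R : idomainType) (a : {fraction R}) :
  exists n d, d != 0 /\ a = FracField.tofrac n / FracField.tofrac d.
Proof.
elim/quotW: a => r; exists (frac r).1, (frac r).2.
have d0 := denom_ratioP r; split=> //; apply: (canRL (mulfK _)).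
  by rewrite tofrac_eq0.
unlock FracField.tofrac; rewrite -[LHS]FracField.pi_mul; apply/eqmodP => /=.
by rewrite FracField.equivfE /FracField.mulf !numden_Ratio ?mulr1 ?oner_eq0 // mulrC.
Qed.

Lemma subring_Fp_emb (V : K -> Prop) (sV : is_subring V) c : V (Fp_emb K c).
Proof. by rewrite -(natr_Zp c) rmorph_nat; apply: subring_nat. Qed.

Lemma subring_ev (V : K -> Prop) (sV : is_subring V) s f : V s -> V (ev s f).
Proof.
by move=> Vs; apply: subring_horner => // i; rewrite coef_map; apply: subring_Fp_emb.
Qed.

(** Numerators and denominators reduce the claim to polynomials in [t]. When [s] is [t^-1], the
    reversal [g] of [f] satisfies g(s) = s^n f(t), and powers of [s] lie in [G]. *)
Lemma base_subgroup (s : K) (G : K -> Prop) :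
  s = t \/ s = t^-1 ->
  (forall x y, G x -> G y -> G (x * y)) -> (forall x, G x -> G x^-1) ->
  (forall f, ev s f != 0 -> G (ev s f)) ->
  forall a : Fpt p, a != 0 -> G a%:A.
Proof.
move=> st GM GV Gev.
have A0 (a : Fpt p) : a != 0 -> a%:A != 0 :> K.
  by move=> a0; rewrite scaler_eq0 negb_or a0 oner_eq0.
have t0 : t != 0 by rewrite A0 // tofrac_eq0 polyX_eq0.
have s0 : s != 0 by case: st => ->; rewrite ?invr_eq0.
have Gs : G s by have := Gev 'X; rewrite map_polyX hornerX; apply.
have G1 : G 1 by have := Gev 1; rewrite rmorph1 hornerC; apply; apply: oner_neq0.
have GX n : G (s ^+ n) by elim: n => [//|n IHn]; rewrite exprS; apply: GM.
have Gt f : f != 0 -> G (ev t f).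
  move=> f0; have ev0 : ev t f != 0 by rewrite -tofrac_algE A0 // tofrac_eq0.
  case: st => st; first by rewrite -st; apply: Gev; rewrite st.
  pose n := size f; pose g := \poly_(i < n.+1) f`_(n - i).
  have eg : ev s g = s ^+ n * ev t f.
    rewrite -[t in RHS]invrK -st -horner_rev //; last first.
      by rewrite leqW // /n size_map_poly.
    congr (_.[s]); apply/polyP => i; rewrite coef_map [in LHS]coef_poly [RHS]coef_poly.
    by case: ifP => _; rewrite ?coef_map //= rmorph0.
  have -> : ev t f = (s ^+ n)^-1 * ev s g by rewrite eg mulKf ?expf_neq0.
  apply: GM; first exact: GV.
  by apply: Gev; rewrite eg mulf_neq0 ?expf_neq0.
move=> a a0; have [n [d [d0 e]]] := fraction_numden a.
have n0 : n != 0 by apply: contra_neq a0 => n0; rewrite e n0 tofrac0 mul0r.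
rewrite e -in_algE rmorphM fmorphV /= !tofrac_algE.
by apply: GM; [|apply: GV]; apply: Gt.
Qed.

(** With [s] chosen in [V] among [t] and [t^-1], all of F_p[s] lies in [V]. A polynomial [g] of
    least size whose value is a nonzero non-unit gives [pi], and Euclidean division by [g] extracts
    the powers of [pi]. *)
Lemma exists_uniformizer (V : K -> Prop) :
  is_subring V -> (forall x, V x \/ V x^-1) ->
  (exists2 a : Fpt p, a != 0 & ~ vunit V a%:A) ->
  exists pi : K, [/\ V pi, ~ V pi^-1 &
    forall a : Fpt p, a != 0 -> exists n : int, vunit V (a%:A / pi ^ n)].
Proof.
move=> sV valV [a0 a0_neq0 Ua0].
have [s st Vs] : exists2 s, s = t \/ s = t^-1 & V s.
  by case: (valV t) => Vt; [exists t | exists t^-1] => //; [left | right].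
have Vev f : V (ev s f) by apply: subring_ev.
pose P n := `[< exists f : {poly 'F_p},
    [/\ size f = n, ev s f != 0 & ~ vunit V (ev s f)] >].
have exP : exists n, P n.
  apply: contrapT => nP; apply: Ua0.
  apply: (base_subgroup st) a0_neq0 => [x y|x|f f0].
  - exact: vunitM.
  - exact: vunitV.
  - by apply: contrapT => Uf; apply: nP; exists (size f); apply/asboolP; exists f.
case: (ex_minnP exP) => _ /asboolP [g [<- g0 Ug]] ming.
have {}ming (f : {poly 'F_p}) : (size f < size g)%N -> ev s f != 0 -> vunit V (ev s f).
  move=> lt_fg f0; apply: contrapT => Uf.
  have /ming : P (size f) by apply/asboolP; exists f.
  by rewrite leqNgt lt_fg.
pose pi := ev s g; have Vgs : V pi by apply: Vev.
have Vpi : ~ V pi^-1 by move=> Vpi; apply: Ug.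
(* Nonzero constants are units of [V], so [g] is not constant and division by it lowers the size. *)
have size_g : (1 < size g)%N.
  rewrite ltnNge; apply/negP => /size1_polyC e; apply: Vpi.
  rewrite /pi e map_polyC hornerC -fmorphV; exact: subring_Fp_emb.
have g_neq0 : g != 0 by rewrite -size_poly_gt0 ltnW.
have pow_pi (f : {poly 'F_p}) : ev s f != 0 ->
    exists n : nat, vunit V (ev s f / pi ^+ n).
  have [m] := ubnP (size f); elim: m f => // m IHm f lt_f f0.
  have ef : ev s f = ev s (f %/ g) * pi + ev s (f %% g).
    by rewrite {1}(divp_eq f g) rmorphD rmorphM /= hornerD hornerM.
  have [r0|r0] := eqVneq (ev s (f %% g)) 0.
    rewrite r0 addr0 in ef.
    have q0 : ev s (f %/ g) != 0 by apply: contra_neq f0 => q0; rewrite ef q0 mul0r.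
    have [||n Un] := IHm (f %/ g) => //.
      have f_neq0 : f != 0 by apply: contra_neq f0 => ->; rewrite rmorph0 horner0.
      rewrite size_divp //; move: lt_f size_g f_neq0; rewrite -size_poly_gt0.
      by move: (size f) (size g); lia.
    exists n.+1; rewrite ef exprSr invfM mulrACA.
    have -> : pi / pi = 1 by rewrite mulfV.
    by rewrite mulr1.
  (* A nonzero remainder is a unit by minimality of [g]; dividing by it leaves 1 plus a multiple of
     [pi], which is a unit because [pi] is not. *)
  exists 0%N; rewrite expr0 divr1.
  have Ur := ming _ _ r0; rewrite ltn_modp in Ur; move/(_ g_neq0): Ur => Ur.
  have -> : ev s f = ev s (f %% g) * (1 + ev s (f %/ g) * pi / ev s (f %% g)).
    by rewrite ef; field.
  case: (Ur) => _ _ VVr; apply: vunitM => //; apply: vunit_add1 => //.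
    by do 2!apply: subringM => //.
  case=> q0 _ VVq; apply: Vpi.
  move: q0; rewrite !mulf_eq0 !negb_or invr_eq0 r0 => /andP [/andP [q0 pi0] _].
  have -> : pi^-1 =
      ev s (f %/ g) / ev s (f %% g) * (ev s (f %/ g) * pi / ev s (f %% g))^-1.
    by field; rewrite q0 r0 pi0.
  by do 2!apply: subringM => //.
exists pi; split=> //.
have pi0 : pi != 0 := g0.
apply: (base_subgroup (G := fun y => exists n : int, vunit V (y / pi ^ n)) st)
  => [x y [n Un] [m Um]|x [n Un]|f /pow_pi [n Un]].
- by exists (n + m); rewrite expfzDr // invfM mulrACA; apply: vunitM.
- by exists (- n); rewrite -invr_expz -invfM; apply: vunitV.
- by exists n.
Qed.

End FunctionField.

(** * From valuation rings to normalized places *)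

Lemma exists_place_of_valuation (K : fieldType) (w : K -> int) (u : K) :
  (forall x y, x != 0 -> y != 0 -> w (x * y) = w x + w y) ->
  (forall x y, x != 0 -> y != 0 -> x + y != 0 -> Order.min (w x) (w y) <= w (x + y)) ->
  u != 0 -> 0 < w u ->
  exists2 v : K -> int, is_place v & 0 < v u.
Proof.
move=> wM wD u0 wu.
have w1 : w 1 = 0 by have := wM 1 1 (oner_neq0 _) (oner_neq0 _); rewrite mulr1; lia.
have wV x : x != 0 -> w x^-1 = - w x.
  move=> x0; have := wM x x^-1 x0; rewrite invr_eq0 mulfV // w1 => /(_ x0); lia.
have wX x n : x != 0 -> w (x ^+ n) = w x * n%:Z.
  move=> x0; elim: n => [|n IHn]; first by rewrite w1 mulr0.
  by rewrite exprS wM ?expf_neq0 // IHn; lia.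
have wXz x n : x != 0 -> w (x ^ n) = w x * n.
  move=> x0; case: n => n; first exact: wX.
  by rewrite NegzE -exprnN wV ?expf_neq0 // wX //; lia.
(* The least positive value [d] will divide every value, and [w] divided by [d] is normalized. *)
pose P n := `[< (0 < n)%N /\ exists2 x, x != 0 & w x = n%:Z >].
have exP : exists n, P n.
  by exists `|w u|%N; apply/asboolP; split; [lia | exists u => //; lia].
case: (ex_minnP exP) => d /asboolP [d0 [z z0 wz]] mind.
have [v dvd] : exists v : K -> int, forall x, x != 0 -> v x * d%:Z = w x.
  exists (fun x => (w x %/ d)%Z) => x x0; set q := (w x %/ d)%Z.
  have y0 : x * z ^ (- q) != 0 by rewrite mulf_neq0 ?expfz_neq0.
  have := wM x (z ^ (- q)) x0; rewrite wXz // wz expfz_neq0 // => /(_ isT) wy.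
  (* A nonzero remainder would be a positive value below [d], taken at [x * z ^ (- q)]. *)
  have [r0|r0] := eqVneq (w x %% d)%Z 0; first by rewrite [RHS](divz_eq _ d) r0 addr0.
  have r_ge0 : (0 <= w x %% d)%Z by rewrite modz_ge0 // -lt0n.
  have r_lt : (w x %% d < d)%Z by rewrite ltz_pmod.
  have eqr : w (x * z ^ (- q)) = (w x %% d)%Z.
    by rewrite wy {1}(divz_eq (w x) d) -/q; ring.
  have : P `|(w x %% d)%Z|%N.
    apply/asboolP; split; first by rewrite absz_gt0.
    by exists (x * z ^ (- q)) => //; rewrite eqr gez0_abs.
  by move/mind; lia.
have {}d0 : 0 < d%:Z by [].
exists v; last first.
  by rewrite -(pmulr_lgt0 _ d0) dvd.
have d_neq0 : d%:Z != 0 by rewrite gt_eqF.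
split=> [x y x0 y0|x y x0 y0 xy0|].
- by apply: (mulIf d_neq0); rewrite mulrDl !dvd ?mulf_neq0 ?wM.
- by rewrite -(ler_pM2r d0) minr_pMl 1?(ltW d0) // !dvd //; apply: wD.
- by exists z; split=> //; apply: (mulIf d_neq0); rewrite mul1r dvd.
Qed.

(** The valuation [w x] is the exponent of the power of [pi] associate to [x ^+ M], where [M] is the
    factorial of the degree; it is additive because only the zeroth power of [pi] is a unit. *)
Lemma valuation_ring_place (p : nat) (K : fieldExtType (Fpt p)) (V : K -> Prop) (u : K) :
  is_subring V -> (forall x, V x \/ V x^-1) -> V u -> ~ V u^-1 ->
  exists2 v : K -> int, is_place v & 0 < v u.
Proof.
move=> sV valV Vu VVu.
have u0 : u != 0 by apply/eqP => u0; apply: VVu; rewrite u0 invr0 -u0.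
have M0 := fact_gt0 (\dim {:K}); have powM := exprfact_assoc_base sV valV.
move: _`! M0 powM => M M0 powM.
have [|pi [Vpi VVpi base_pi]] := exists_uniformizer sV valV.
  (* If the base element associate to [u ^+ M] were a unit, then so would be [u ^+ M], and hence
     [u]. *)
  have [a a0 Ua] := powM _ u0; exists a => // U.
  have : vunit V (u ^+ M).
    by rewrite -(divfK (x := a%:A) _ (u ^+ M)); [apply: vunitM | case: U].
  by move/(vunit_of_exp sV valV M0 u0) => [].
have pi0 : pi != 0 by apply/eqP => e; apply: VVpi; rewrite e invr0 -e.
have pow_unit k : ~ vunit V (pi ^+ k.+1).
  by move/(vunit_of_exp sV valV (ltn0Sn k) pi0) => [].
have pi_uniq n : vunit V (pi ^ n) -> n = 0.
  case: n => [[|k]|k] //; first by move=> /(pow_unit k).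
  by move/vunitV; rewrite NegzE -exprnN invrK => /(pow_unit k).
have Vpi_ge0 n : V (pi ^ n) -> 0 <= n.
  case: n => // k; rewrite NegzE -exprnN => Vk; case: (pow_unit k).
  by split=> //; [rewrite expf_neq0 | apply: subringX].
have [w hw] : exists w : K -> int,
    forall x, x != 0 -> vunit V (x ^+ M / pi ^ w x).
  suff /choice [w hw] : forall x : K,
      exists n : int, x != 0 -> vunit V (x ^+ M / pi ^ n).
    by exists w.
  move=> x; have [->|x0] := eqVneq x 0; first by exists 0.
  have [a a0 Ua] := powM _ x0; have [n Un] := base_pi a a0; exists n => _.
  have A0 : a%:A != 0 :> K by rewrite scaler_eq0 negb_or a0 oner_eq0.
  have -> : x ^+ M / pi ^ n = x ^+ M / a%:A * (a%:A / pi ^ n) by rewrite mulrA divfK.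
  exact: vunitM.
have wM x y : x != 0 -> y != 0 -> w (x * y) = w x + w y.
  move=> x0 y0; apply/eqP; rewrite -subr_eq0; apply/eqP/pi_uniq.
  have -> : pi ^ (w (x * y) - (w x + w y)) =
      (x ^+ M / pi ^ w x) * (y ^+ M / pi ^ w y) / ((x * y) ^+ M / pi ^ w (x * y)).
    rewrite !expfzDr // -invr_expz expfzDr // exprMn.
    have := expf_neq0 M x0; have := expf_neq0 M y0.
    have := expfz_neq0 (w x) pi0; have := expfz_neq0 (w y) pi0.
    have := expfz_neq0 (w (x * y)) pi0.
    move: (x ^+ M) (y ^+ M) (pi ^ w x) (pi ^ w y) (pi ^ w (x * y)) => X Y A B C.
    by move=> C0 B0 A0 Y0 X0; field; rewrite A0 B0 C0 X0 Y0.
  apply: vunitM => //; first by apply: vunitM => //; apply: hw.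
  by apply/vunitV/hw; rewrite mulf_neq0.
(* Identifying [V] with the elements of nonnegative [w] turns closure of [V] under addition into the
   ultrametric inequality. *)
have w_ge0 x : x != 0 -> V x <-> 0 <= w x.
  move=> x0; have [_ V1 V2] := hw x x0.
  have xM0 := expf_neq0 M x0; have piw0 := expfz_neq0 (w x) pi0.
  split=> [Vx|w0].
    apply: Vpi_ge0; have -> : pi ^ w x = x ^+ M * (x ^+ M / pi ^ w x)^-1.
      by rewrite invf_div mulrCA mulfV ?mulr1.
    by apply: subringM => //; apply: subringX.
  have VxM : V (x ^+ M).
    rewrite -(divfK piw0 (x ^+ M)); apply: subringM => //.
    by case: (w x) w0 => // k _; apply: subringX.
  case: (valV x) => // VVx.
  have /(vunit_of_exp sV valV M0 x0) [] // : vunit V (x ^+ M).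
  by split=> //; rewrite -exprVn; apply: subringX.
apply: (@exists_place_of_valuation _ w u wM _ u0); last first.
  have Vu0 : u^-1 != 0 by rewrite invr_eq0.
  have w1 : w 1 = 0.
    by apply: (addrI (w 1)); rewrite addr0 -wM ?oner_neq0 // mulr1.
  have wVu : w u^-1 = - w u.
    by apply: (addrI (w u)); rewrite subrr -wM // mulfV.
  by rewrite -oppr_lt0 -wVu ltNge; apply/negP => /(w_ge0 _ Vu0).
suff wD x y : x != 0 -> y != 0 -> x + y != 0 -> w x <= w y -> w x <= w (x + y).
  move=> x y x0 y0 xy0; rewrite minEle; case: ifP => [|/negbT]; first exact: wD.
  by rewrite -ltNge => /ltW; rewrite addrC; apply: wD; rewrite // addrC.
move=> x0 y0 xy0 wxy; have yx0 : y / x != 0 by rewrite mulf_neq0 ?invr_eq0.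
have ey : y = y / x * x by rewrite mulfVK.
have exy : x + y = (1 + y / x) * x by rewrite mulrDl mul1r mulfVK.
have xy10 : 1 + y / x != 0 by apply: contra_neq xy0 => e; rewrite exy e mul0r.
have Vyx : V (y / x).
  by apply/w_ge0 => //; move: wxy; rewrite {1}ey wM // lerDr.
have : V (1 + y / x) by apply: subringD => //; apply: subring1.
by move/(w_ge0 _ xy10); rewrite exy wM // lerDr.
Qed.

(** Start from the ring F_p[u]: an equation [u^-1 = f.[u]] would make [u] a root of [f * 'X - 1],
    which is nonzero because its constant coefficient is -1. *)
Lemma exists_place (p : nat) (K : fieldExtType (Fpt p)) (u : K) :
  ~ is_constant u -> exists2 v : K -> int, is_place v & 0 < v u.
Proof.
move=> Cu; have u0 : u != 0.
  apply/eqP => u0; apply: Cu; exists 'X; rewrite polyX_eq0; split=> //.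
  by rewrite u0 map_polyX /root hornerX.
pose A y := exists f : {poly 'F_p}, y = (map_poly (@Fp_emb p K) f).[u].
have [||[f ef]|V [sV AV VVu valV]] := @exists_valuation_ring K A u.
- split.
  + by exists 1; rewrite rmorph1 hornerC.
  + by move=> _ _ [f ->] [g ->]; exists (f - g); rewrite rmorphB !hornerE.
  + by move=> _ _ [f ->] [g ->]; exists (f * g); rewrite rmorphM hornerM.
- by exists 'X; rewrite map_polyX hornerX.
- apply: Cu; exists (f * 'X - 1); split.
    apply/eqP => /(congr1 (fun h : {poly 'F_p} => h`_0)) /eqP.
    by rewrite coefB coefMX coef1 coef0 sub0r oppr_eq0 oner_eq0.
  rewrite /root rmorphB rmorphM rmorph1 /= map_polyX !hornerE -ef.
  by rewrite mulVf // subrr.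
- apply: (valuation_ring_place sV valV _ VVu); apply: AV.
  by exists 'X; rewrite map_polyX hornerX.
Qed.

(** * The ring [O] and its units *)

Definition place_ring (K : fieldType) (v : K -> int) (x : K) : Prop :=
  x != 0 -> 0 <= v x.

Lemma place1 (K : fieldType) (v : K -> int) : is_place v -> v 1 = 0.
Proof.
case=> vM _ _; apply: (addrI (v 1)).
by rewrite addr0 -vM ?oner_neq0 // mulr1.
Qed.

Lemma placeV (K : fieldType) (v : K -> int) (x : K) :
  is_place v -> x != 0 -> v x^-1 = - v x.
Proof.
move=> pv x0; have [vM _ _] := pv; apply: (addrI (v x)).
by rewrite subrr -vM ?invr_eq0 // mulfV // place1.
Qed.

Lemma place_ring_subring (K : fieldType) (v : K -> int) :
  is_place v -> is_subring (place_ring v).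
Proof.
move=> pv; have [vM vD _] := pv; have v1 := place1 pv.
have vN1 : v (-1) = 0.
  have := vM (-1) (-1); rewrite oppr_eq0 oner_neq0 => /(_ isT isT).
  by rewrite mulrNN mulr1 v1; lia.
split=> [_|x y Vx Vy xy0|x y Vx Vy]; first by rewrite v1.
(* The value [v 0] is arbitrary, so zero arguments are treated apart. *)
- have [x0|x0] := eqVneq x 0; last have [y0|y0] := eqVneq y 0.
  + have y0 : y != 0 by move: xy0; rewrite x0 sub0r oppr_eq0.
    rewrite x0 sub0r -mulN1r vM ?oppr_eq0 ?oner_eq0 // vN1 add0r; exact: Vy.
  + by rewrite y0 subr0; apply: Vx.
  + apply: le_trans (vD x (- y) x0 _ xy0); last by rewrite oppr_eq0.
    rewrite le_min Vx //= -mulN1r vM ?oppr_eq0 ?oner_eq0 // vN1 add0r; exact: Vy.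
- move=> xy0; move: (xy0); rewrite mulf_eq0 negb_or => /andP [x0 y0].
  by rewrite vM // addr_ge0 ?Vx ?Vy.
Qed.

Lemma in_O_subring (K : fieldType) (vinf : K -> int) : is_subring (in_O vinf).
Proof.
split=> [|x y Ox Oy|x y Ox Oy] v pv nv; have sv := place_ring_subring pv.
- exact: (subring1 sv).
- exact: (subringB sv (Ox v pv nv) (Oy v pv nv)).
- exact: (subringM sv (Ox v pv nv) (Oy v pv nv)).
Qed.

(* A nonconstant unit would have a zero and a pole; these are distinct places, so
   one of them differs from the place at infinity. *)
Lemma unit_O_constant (p : nat) (K : fieldExtType (Fpt p)) (vinf : K -> int) (u : K) :
  unit_O vinf u -> is_constant u.
Proof.
case=> u0 Ou OVu; apply: contrapT => Cu.
have CVu : ~ is_constant u^-1.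
  move=> h; apply: Cu; case: (@algebraic_inv _ _ (@Fp_emb p K) u^-1).
    by case: h => a [a0 ra]; exists a.
  by move=> a a0; rewrite invrK; exists a.
have [v pv vu] := exists_place Cu; have [w pw wu] := exists_place CVu.
have v_inf : same_place v vinf.
  apply: contrapT => nv; have := OVu v pv nv.
  by rewrite invr_eq0 u0 placeV // => /(_ isT); rewrite oppr_ge0 leNgt vu.
have w_inf : same_place w vinf.
  apply: contrapT => nw; have := Ou w pw nw.
  by move/(_ u0); move: wu; rewrite placeV // oppr_gt0 ltNge => /negP.
move: wu; rewrite placeV // w_inf // -v_inf // oppr_gt0 => /lt_trans /(_ vu).
by rewrite ltxx.
Qed.

(** * Integrality of periodic points *)

Lemma escape_subring (K : fieldType) (A : K -> Prop) (phi : {poly K}) (y : K) :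
  is_subring A -> (forall i, A phi`_i) -> (2 < size phi)%N -> A (lead_coef phi)^-1 ->
  A y^-1 -> A (phi.[y] / y) -> A y.
Proof.
move=> sA Aphi sz Alead AVy Aq.
have [->|y0] := eqVneq y 0; first exact: subring0.
have [d ed] : exists d, size phi = d.+3.
  by case: (size phi) sz => [|[|[|d]]] // _; exists d.
(* With z = 1/y, r(z) = z^(d+2) phi(y), and r(0) is the leading coefficient. Multiplying r(z) - r(0)
   = g z by y gives lead * y = z^d (phi(y)/y) - g; degree at least 2 keeps the exponent d
   nonnegative. *)
pose r := \poly_(i < d.+3) phi`_(d.+2 - i).
have Ar i : A r`_i by rewrite coef_poly; case: ifP => // _; apply: subring0.
have er : r.[y^-1] = y^-1 ^+ d.+2 * phi.[y].
  by rewrite /r horner_rev ?invr_eq0 ?ed // invrK.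
have r0 : r.[0] = lead_coef phi.
  by rewrite horner_coef0 coef_poly /= subn0 lead_coefE ed.
have [g Ag eg] := subring_hornerB sA Ar AVy (subring0 sA).
have lead0 : lead_coef phi != 0 by rewrite lead_coef_eq0 -size_poly_eq0 ed.
have -> : y = (y^-1 ^+ d * (phi.[y] / y) - g) * (lead_coef phi)^-1.
  apply: (mulIf lead0); rewrite mulfVK //; apply: (mulfI (x := y^-1)).
    by rewrite invr_eq0.
  rewrite mulKf // -[LHS](subKr r.[y^-1]) -r0 eg er subr0 !exprS; ring.
apply: subringM => //; apply: subringB => //; apply: subringM => //.
exact: subringX.
Qed.

(** By [escape_subring] in the ring of a place where [y] has a pole, [phi.[y] / y] is not regular
    there, so [phi.[y]] has a strictly smaller value. *)
Lemma periodic_in_O (K : fieldType) (vinf : K -> int) (phi : {poly K}) (x : K) n :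
  (forall i, in_O vinf phi`_i) -> (2 < size phi)%N -> unit_O vinf (lead_coef phi) ->
  (0 < n)%N -> iter n (fun y => phi.[y]) x = x -> in_O vinf x.
Proof.
move=> Ophi sz [_ _ Olead] n0 per v pv nv x0; apply: contrapT => /negP.
rewrite -ltNge => vx.
have sv := place_ring_subring pv; have [vM _ _] := pv.
have step y : y != 0 -> v y < 0 -> phi.[y] != 0 /\ v phi.[y] < v y.
  move=> y0 vy.
  have AVy : place_ring v y^-1 by move=> _; rewrite placeV // oppr_ge0 ltW.
  have nAq : ~ place_ring v (phi.[y] / y).
    move=> Aq; have Av i := Ophi i v pv nv.
    have := escape_subring sv Av sz (Olead v pv nv) AVy Aq y0.
    by rewrite leNgt vy.
  split; first by apply/eqP => e; apply: nAq; rewrite e mul0r; apply: subring0.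
  rewrite ltNge; apply/negP => le; apply: nAq => q0.
  have f0 : phi.[y] != 0 by apply: contra_neq q0 => ->; rewrite mul0r.
  by rewrite vM ?invr_eq0 // placeV // subr_ge0.
have descent k : iter k.+1 (fun y => phi.[y]) x != 0 /\
    v (iter k.+1 (fun y => phi.[y]) x) < v x.
  elim: k => [|k [y0 vy]]; first exact: step.
  have [] := step _ y0 (lt_trans vy vx); split=> //; exact: lt_trans vy.
by case: n n0 per => // n _ per; have [_] := descent n; rewrite per ltxx.
Qed.

(** * Cycles and the bound on the period *)

Lemma orbit_collinear (K : fieldType) (vinf : K -> int) (phi : {poly K}) (x : K) n i :
  let X k := iter k (fun y => phi.[y]) x in
  (forall i, in_O vinf phi`_i) -> in_O vinf x -> (0 < n)%N -> X n = x ->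
  phi.[x] != x ->
  exists2 g, unit_O vinf g & X i.+1 - X i = g * (phi.[x] - x).
Proof.
move=> X Ophi Ox n0 per fx; have sO := in_O_subring vinf.
have OX k : in_O vinf (X k) by elim: k => // k IHk; apply: (subring_horner sO Ophi IHk).
have mult k l : exists2 g, in_O vinf g &
    X (l + k).+1 - X (l + k)%N = g * (X k.+1 - X k).
  elim: l => [|l [g Og IHl]]; first by exists 1; [apply: (subring1 sO) | rewrite mul1r].
  have [h Oh eh] := subring_hornerB sO Ophi (OX (l + k).+1) (OX (l + k)%N).
  by exists (h * g); [apply: (subringM sO) | rewrite -mulrA -IHl -eh].
have perM k : X (k * n)%N = x.
  by elim: k => // k IHk; rewrite mulSn addnC /X iterD -/(X n) per.
have [g Og eg] := mult 0%N i; rewrite addn0 in eg.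
(* Going on from index [i] to [i * n], a return to [x], the difference becomes [phi.[x] - x] again,
   so the two multipliers satisfy h * g = 1. *)
have [h Oh eh] := mult i (i * n - i)%N.
move: eh; rewrite subnK ?leq_pmulr // {1}/X iterS -/(X _) perM eg mulrA.
have d0 : phi.[x] - x != 0 by rewrite subr_eq0.
rewrite -[LHS]mul1r => /(mulIf d0) hg.
have g0 : g != 0 by apply: contra_eq_neq hg => ->; rewrite mulr0 oner_neq0.
exists g => //; split=> //.
by rewrite -[g^-1]mul1r hg mulfK.
Qed.

Lemma is_constantD (p : nat) (K : fieldExtType (Fpt p)) (x y : K) :
  is_constant x -> is_constant y -> is_constant (x + y).
Proof.
case=> a [a0 ra] [b [b0 rb]].
have [||c c0 rc] := @algebraic_add _ _ (@Fp_emb p K) x y; last by exists c.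
  by exists a.
by exists b.
Qed.

Lemma is_constant0 (p : nat) (K : fieldExtType (Fpt p)) : is_constant (0 : K).
Proof. by exists 'X; rewrite polyX_eq0 map_polyX /root hornerX. Qed.

Theorem theorem2p2 (p : nat) (hp : prime p) (K : fieldExtType (Fpt p))
  (vinf : K -> int) (hinf : is_place vinf)
  (q : nat)
  (hq : exists s : seq K, [/\ uniq s, size s = q &
          forall x : K, x \in s <-> is_constant x])
  (phi : {poly K})
  (hcoef : forall i : nat, in_O vinf phi`_i)
  (hdeg : (3 <= size phi)%N)
  (hlead : unit_O vinf (lead_coef phi))
  (x : K) (n : nat) (hn : (0 < n)%N)
  (hper : iter n (fun y => phi.[y]) x = x) :
  in_O vinf x /\
  exists m : nat, [/\ (0 < m)%N, iter m (fun y => phi.[y]) x = x,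
    (forall k : nat, (0 < k)%N -> (k < m)%N -> iter k (fun y => phi.[y]) x != x)
    & (m <= q)%N].
Proof.
have Ox := periodic_in_O hcoef hdeg hlead hn hper; split=> //.
pose X k := iter k (fun y => phi.[y]) x.
have exm : exists m, (0 < m)%N && (X m == x) by exists n; rewrite hn; apply/eqP.
case: (ex_minnP exm) => m /andP [m0 /eqP perm] minm.
have aper k : (0 < k)%N -> (k < m)%N -> X k != x.
  move=> k0 km; apply/eqP => e.
  by have := minm k; rewrite k0 e eqxx leqNgt km => /(_ isT).
exists m; split=> //.
have [s [us <- sP]] := hq.
(* At a fixed point the direction [phi.[x] - x] vanishes; there the period is 1, and 0 is already
   one constant. *)
have [fx|fx] := eqVneq phi.[x] x.
  apply: leq_trans (minm 1%N _) _; first by rewrite /= fx eqxx.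
  by have /sP := is_constant0 K; case: (s).
(* The coefficients [c] are partial sums of the unit multipliers of successive differences. *)
have [c hc] : exists c : nat -> K,
    forall i, is_constant (c i) /\ X i = x + c i * (phi.[x] - x).
  suff /choice [c hc] : forall i,
      exists c : K, is_constant c /\ X i = x + c * (phi.[x] - x).
    by exists c.
  elim=> [|i [c [Cc ec]]].
    by exists 0; split; [apply: is_constant0 | rewrite mul0r addr0].
  have [g Ug eg] := orbit_collinear i hcoef Ox hn hper fx.
  exists (g + c); split; first by apply: is_constantD => //; apply: unit_O_constant Ug.
  by rewrite mulrDl -eg -/(X _) -/(X _) addrCA -ec subrK.
(* A coincidence, pushed forward by [m - j] steps, would return to [x] after [m - j + i < m]
   steps. *)
have injX i j : (i < j)%N -> (j < m)%N -> X i != X j.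
  move=> ij jm; have : X (m - j + i)%N != x by apply: aper; lia.
  by apply: contra_neq => e; rewrite /X iterD -/(X i) e -iterD subnK ?(ltnW jm).
have uc : uniq [seq c i | i <- iota 0 m].
  rewrite map_inj_in_uniq ?iota_uniq // => i j.
  rewrite !mem_iota !add0n => /andP [_ im] /andP [_ jm] ec.
  have eX : X i = X j by rewrite (hc i).2 (hc j).2 ec.
  have [ij|ij|//] := ltngtP i j.
    by have := injX _ _ ij jm; rewrite eX eqxx.
  by have := injX _ _ ij im; rewrite eX eqxx.
rewrite -(size_iota 0 m) -(size_map c); apply: uniq_leq_size => // _ /mapP [i _ ->].
by apply/sP; case: (hc i).
Qed.
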